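(* For $x > 0$ let $G(x) = \Gamma(x+1)^{1/x}$, where $\Gamma$ is the gamma function, and let $a(x) = (eG'(x) - 1)x$. For $n \geq 1$ let $S_n = e\sqrt[n+1]{(n+1)!} - e\sqrt[n]{n!}$. Then: (a) $\lim_{n \to \infty} S_n = 1$. (b) $1.15 > S_1 > S_2 > S_3 > \cdots > 1$. (c) $1 + \frac{a(n+1)}{n+1} < S_n < 1 + \frac{a(n)}{n}$ for all integers $n \geq 18$. (d) $\lim_{n \to \infty} a(n) = \frac{1}{2}$. *)

(* Defs.v *)
From mathcomp Require Import all_boot all_order all_algebra.
From mathcomp Require Import all_classical all_reals all_analysis.
Set Implicit Arguments.
Unset Strict Implicit.
Unset Printing Implicit Defensive.
Import Order.TTheory GRing.Theory Num.Theory.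
Import numFieldNormedType.Exports.
Local Open Scope classical_set_scope.
Local Open Scope ring_scope.

(* Euler's integral of the second kind; meaningful for 0 < x, where the
   integrand is Lebesgue-integrable. *)
Definition Gamma (R : realType) (x : R) : R :=
  \int[@lebesgue_measure R]_(t in `]0, +oo[) (t `^ (x - 1) * expR (- t)).

(* Meaningful for 0 < x, as is [aG]. *)
Definition Groot (R : realType) (x : R) : R := Gamma (x + 1) `^ x^-1.

Definition aG (R : realType) (x : R) : R :=
  (expR 1 * derive1 (@Groot R) x - 1) * x.

(* Meaningful for 1 <= n. *)
Definition Sdiff (R : realType) (n : nat) : R :=
  expR 1 * (n.+1`!%:R `^ n.+1%:R^-1) - expR 1 * (n`!%:R `^ n%:R^-1).

(* Main.v *)
Require Import Defs.
From mathcomp Require Import all_boot all_order all_algebra.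
From mathcomp Require Import all_classical all_reals all_analysis.
From mathcomp Require Import measurable_realfun ring lra.
Import Order.TTheory GRing.Theory Num.Theory.
Import numFieldNormedType.Exports.
Local Open Scope classical_set_scope.
Local Open Scope ring_scope.
Set Implicit Arguments.
Unset Strict Implicit.
Unset Printing Implicit Defensive.

(** Write f(x) = ln Gamma(x + 1) and G(x) = exp (f(x) / x).  Integration by
    parts and a pointwise convexity inequality show that f is convex with
    f(x + 1) = f(x) + ln (x + 1), so the Bohr-Mollerup argument makes f the limit
    of Euler's finite products.  Their second order remainders are uniformly
    bounded, hence f is twice differentiable, and telescoping gives
    1/x - 1/(2x^2) <= f'' <= 1/x - 1/(2x^2) + 1/(6x^3).  Integrating from +oo
    bounds f', and integrating from 1, where f vanishes, yields
    11/12 <= f(x) - (x ln x - x + (ln x)/2) <= 1 for x >= 1; the exact constant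
    of Stirling's formula is never needed.

    With u = f' - f/x, the sign of G'' is that of x f'' - 1 + (1 - u)^2, which
    these bounds make negative for x >= 2.  As 1 + a(x)/x = e G'(x), the mean value
    theorem then gives e G'(n + 1) < S_n < e G'(n) for n >= 2, whence (c) and the
    monotonicity in (b), up to the numerical check of S_2 < S_1.
    The same bounds squeeze a(x) between 1/2 - 5 / sqrt x and
    exp (2 / sqrt x) / 2, which is (d), and (d) implies (a). *)

Lemma is_derive1_continuous {R : realType} (f : R -> R) (x df : R) :
  is_derive x 1 f df -> f y @[y --> x] --> f x.
Proof. by move=> ?; exact/differentiable_continuous/derivable1_diffP/ex_derive. Qed.

(** * Euler's integral: integrability, functional equation and log-convexity *)

Section gamma_integral.
Context {R : realType}.
Local Notation mu := (@lebesgue_measure R).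
Implicit Types p t x : R.

(** The integrand of [Gamma (p + 1)]. For [0 < p] it is continuous and vanishes at 0, so the
    integral can be taken over the closed half-line. *)
Definition gammaf p t : R := t `^ p * expR (- t).

(** This is [ln s <= s - 1] at [s = t / (2 * p)]. Half of the decay of [expR (- t)] is kept as an
    integrable majorant. *)
Lemma powR_le_expR p t : 0 < p -> 0 < t ->
  t `^ p <= (2 * p) `^ p * expR (t / 2).
Proof.
move=> p0 t0.
have p20 : 0 < 2 * p by lra.
rewrite /powR !gt_eqF// -expRD ler_expR.
have -> : t / 2 = p * (t / (2 * p)) by field; lra.
rewrite -mulrDr ler_pM2l//.
have := le_ln1Dx (x := t / (2 * p) - 1).
rewrite [1 + _]addrC subrK => /(_ _).
have h : 0 < t / (2 * p) by rewrite divr_gt0.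
rewrite ln_div ?posrE//; lra.
Qed.

Lemma gammaf_le p t : 0 < p -> 0 < t ->
  gammaf p t <= (2 * p) `^ p * expR (- (t / 2)).
Proof.
move=> p0 t0.
rewrite /gammaf (_ : - (t / 2) = t / 2 + - t); last by lra.
by rewrite expRD mulrA ler_wpM2r ?expR_ge0// powR_le_expR.
Qed.

Lemma gammaf_ge0 p t : 0 <= gammaf p t.
Proof. by rewrite mulr_ge0 ?powR_ge0 ?expR_ge0. Qed.

Lemma gammaf0 p : 0 < p -> gammaf p 0 = 0.
Proof. by move=> p0; rewrite /gammaf powR0 ?gt_eqF// mul0r. Qed.

Lemma within_continuous_gammaf p : 0 < p ->
  {within `[0, +oo[, continuous (gammaf p)}.
Proof.
move=> p0.
have cN : continuous (fun t : R => expR (- t)).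
  by move=> t; apply: continuous_comp; [exact: oppr_continuous|exact: continuous_expR].
rewrite /gammaf; apply/continuous_within_itvcyP; split.
  move=> t; rewrite in_itv/= andbT => t0.
  apply: cvgM; last exact: cN.
  exact: (is_derive1_continuous (is_derive1_powR p t0)).
apply: cvgM; last by apply: cvg_at_right_filter; exact: cN.
by rewrite powR0 ?gt_eqF//; exact: powR_cvg0.
Qed.

Lemma measurable_gammaf p : 0 < p -> measurable_fun `[(0 : R), +oo[ (gammaf p).
Proof.
move=> p0; apply: subspace_continuous_measurable_fun => //.
exact: within_continuous_gammaf.
Qed.

Lemma integrable_expR_half :
  mu.-integrable `[0, +oo[ (EFin \o (fun t => expR (- (t / 2)))).
Proof.
(* Up to the factor 2, the integrand is the exponential density of rate 1/2. *)
have h : (0 : R) < 2^-1 by rewrite invr_gt0.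
have i : mu.-integrable `[0, +oo[ (EFin \o exponential_pdf 2^-1).
  exact: integrableS (integrable_exponential_pdf h).
have := @integrableZl _ _ _ mu _ (measurable_itv _) 2 _ i.
apply: eq_integrable => //= t; rewrite inE/= in_itv/= andbT => t0.
by rewrite exponential_pdfE// -EFinM mulrA mulfV// mul1r mulNr mulrC.
Qed.

Lemma Rintegral_expR_half :
  \int[mu]_(t in `[0, +oo[) expR (- (t / 2)) = 2.
Proof.
have dF (t : R) : is_derive t 1 (fun t => - 2 * expR (- (t / 2))) (expR (- (t / 2))).
  by apply: is_derive_eq; rewrite /GRing.scale/=; lra.
have cF : continuous (fun t : R => - 2 * expR (- (t / 2))).
  move=> t; apply/differentiable_continuous/derivable1_diffP.
  exact: ex_derive.
rewrite (@Rintegral_ge0_continuous_FTC2y _ _ (fun t => - 2 * expR (- (t / 2))) 0 0).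
- by rewrite mul0r oppr0 expR0; lra.
- by move=> t _; exact: expR_ge0.
- apply: continuous_subspaceT => t; apply/differentiable_continuous/derivable1_diffP.
  exact: ex_derive.
- rewrite -[X in _ --> X](mulr0 (- 2)); apply: cvgM; first exact: cvg_cst.
  apply: (@cvg_comp _ _ _ (fun t => t / 2) (fun z => expR (- z)) _ (pinfty_nbhs R)).
    by apply: gt0_cvgMly; rewrite ?invr_gt0//.
  exact: cvgr_expR.
- by move=> t _; exact: ex_derive.
- by apply: cvg_at_right_filter; exact: cF.
- by move=> t _; rewrite derive1E; apply: derive_val.
Qed.

Lemma integrable_gammaf p : 0 < p -> mu.-integrable `[0, +oo[ (EFin \o gammaf p).
Proof.
move=> p0.
have := @integrableZl _ _ _ mu _ (measurable_itv _) ((2 * p) `^ p) _ integrable_expR_half.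
apply: le_integrable => //.
  by apply/measurable_EFinP; exact: measurable_gammaf.
move=> t /=; rewrite in_itv/= andbT => t0.
rewrite lee_fin ger0_norm ?gammaf_ge0// ger0_norm ?mulr_ge0 ?powR_ge0 ?expR_ge0//.
move: t0; rewrite le_eqVlt => /predU1P[<-|t0]; last exact: gammaf_le.
by rewrite gammaf0// mulr_ge0 ?powR_ge0 ?expR_ge0.
Qed.

Lemma GammaE p : 0 < p -> Gamma (p + 1) = \int[mu]_(t in `[0, +oo[) gammaf p t.
Proof.
move=> p0; rewrite /Gamma addrK Rintegral_itv_obnd_cbnd//.
apply: integrableS (integrable_gammaf p0) => //.
by apply: subset_itvr; rewrite bnd_simp.
Qed.

Lemma cvg_gammaf p : 0 < p -> gammaf p t @[t --> +oo] --> 0.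
Proof.
move=> p0.
apply: (@squeeze_cvgr _ _ _ _ (fun=> 0) (fun t => (2 * p) `^ p * expR (- (t / 2)))).
- near=> t; rewrite gammaf_ge0/= gammaf_le//.
- exact: cvg_cst.
- rewrite -[X in _ --> X](mulr0 ((2 * p) `^ p)); apply: cvgM; first exact: cvg_cst.
  apply: (@cvg_comp _ _ _ (fun t => t / 2) (fun z => expR (- z)) _ (pinfty_nbhs R)).
    by apply: gt0_cvgMly; rewrite ?invr_gt0//.
  exact: cvgr_expR.
Unshelve. all: by end_near. Qed.

Lemma is_derive_gammaf p t : 0 < t ->
  is_derive t 1 (gammaf (p + 1)) ((p + 1) * gammaf p t - gammaf (p + 1) t).
Proof.
move=> t0; rewrite /gammaf.
have := is_derive1_powR (p + 1) t0; rewrite addrK => h.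
by apply: is_derive_eq; rewrite /GRing.scale/=; ring.
Qed.

(* Adding a multiple of [exp (- t / 2)] makes the derivative of [- t^(p+1) e^-t]
   nonnegative, as the fundamental theorem on [[0, +oo[] requires. *)
Lemma GammaS p : 0 < p -> Gamma (p + 2) = (p + 1) * Gamma (p + 1).
Proof.
move=> p0; have p10 : 0 < p + 1 by lra.
rewrite (_ : p + 2 = (p + 1) + 1); last by lra.
rewrite !GammaE//.
(* By [gammaf_le], this [C] makes [C * expR (- (t / 2))] dominate the negative term
   [(p + 1) * gammaf p t] of [f]. *)
pose C := (p + 1) * (2 * p) `^ p.
pose F t := - gammaf (p + 1) t - 2 * C * expR (- (t / 2)).
pose f t := gammaf (p + 1) t - (p + 1) * gammaf p t + C * expR (- (t / 2)).
have dF t : 0 < t -> is_derive t 1 F (f t).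
  move=> t0; have := is_derive_gammaf p t0 => h.
  by apply: is_derive_eq; rewrite /GRing.scale/= /f; lra.
have cE : continuous (fun t : R => expR (- (t / 2))).
  move=> t; apply/differentiable_continuous/derivable1_diffP.
  exact: ex_derive.
have f0 t : 0 <= t -> 0 <= f t.
  rewrite le_eqVlt => /predU1P[<-|t0]; rewrite /f.
    by rewrite !gammaf0// mulr0 subrr add0r !mulr_ge0 ?powR_ge0 ?expR_ge0 ?(ltW p10).
  have : (p + 1) * gammaf p t <= C * expR (- (t / 2)).
    by rewrite /C -mulrA ler_pM2l// gammaf_le.
  by have := gammaf_ge0 (p + 1) t; lra.
have FTC : \int[mu]_(t in `[0, +oo[) f t = 0 - F 0.
  apply: Rintegral_ge0_continuous_FTC2y => //.
  - apply/continuous_within_itvcyP; split.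
      move=> t; rewrite in_itv/= andbT => t0.
      apply: cvgD; first apply: cvgB.
      + have /continuous_within_itvcyP[+ _] := within_continuous_gammaf p10.
        by apply; rewrite in_itv/= t0.
      + apply: cvgM; first exact: cvg_cst.
        have /continuous_within_itvcyP[+ _] := within_continuous_gammaf p0.
        by apply; rewrite in_itv/= t0.
      + by apply: cvgM; [exact: cvg_cst|exact: cE].
    apply: cvgD; first apply: cvgB.
    + by have /continuous_within_itvcyP[_ +] := within_continuous_gammaf p10.
    + apply: cvgM; first exact: cvg_cst.
      by have /continuous_within_itvcyP[_ +] := within_continuous_gammaf p0.
    + apply: cvgM; first exact: cvg_cst.
      by apply: cvg_at_right_filter; exact: cE.
  - rewrite -[X in _ --> X]subr0 -[X in _ --> X - _]oppr0 /F; apply: cvgB.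
      by apply: cvgN; exact: cvg_gammaf.
    rewrite -[X in _ --> X](mulr0 (2 * C)); apply: cvgM; first exact: cvg_cst.
    apply: (@cvg_comp _ _ _ (fun t => t / 2) (fun z => expR (- z)) _ (pinfty_nbhs R)).
      by apply: gt0_cvgMly; rewrite ?invr_gt0//.
    exact: cvgr_expR.
  - by move=> t /dF ?; exact: ex_derive.
  - apply: cvgB.
      apply: cvgN.
      by have /continuous_within_itvcyP[_ +] := within_continuous_gammaf p10.
    apply: cvgM; first exact: cvg_cst.
    by apply: cvg_at_right_filter; exact: cE.
  - move=> t; rewrite in_itv/= andbT => /dF ?.
    by rewrite derive1E; apply: derive_val.
(* The added exponential integrates to [2 * C], which is also [- F 0]; the two cancel and leave the
   functional equation. *)
move: FTC; rewrite {1}/f.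
have i1 := integrable_gammaf p10.
have i2 := @integrableZl _ _ _ mu _ (measurable_itv _) (p + 1) _ (integrable_gammaf p0).
have i3 := @integrableZl _ _ _ mu _ (measurable_itv _) C _ integrable_expR_half.
have i12 : mu.-integrable `[0, +oo[
    (EFin \o (fun t => gammaf (p + 1) t - (p + 1) * gammaf p t)).
  have := @integrableB _ _ _ mu _ (measurable_itv _) _ _ i1 i2.
  by apply: eq_integrable.
rewrite RintegralD// RintegralB// RintegralZl//; last exact: integrable_gammaf.
rewrite RintegralZl//; last exact: integrable_expR_half.
rewrite Rintegral_expR_half /F gammaf0// mul0r oppr0 expR0; lra.
Qed.

Lemma Gamma2 : Gamma (2 : R) = 1.
Proof.
rewrite (_ : 2 = 1 + 1 :> R); last by lra.
rewrite GammaE//.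
have dF t : is_derive t 1 (fun t : R => - (t + 1) * expR (- t)) (t * expR (- t)).
  by apply: is_derive_eq; rewrite /GRing.scale/=; lra.
have cF : continuous (fun t : R => - (t + 1) * expR (- t)).
  move=> t; apply/differentiable_continuous/derivable1_diffP.
  exact: ex_derive.
under eq_Rintegral.
  move=> t; rewrite inE/= in_itv/= andbT => t0.
  rewrite /gammaf powRr1//; over.
rewrite (@Rintegral_ge0_continuous_FTC2y _ _ (fun t => - (t + 1) * expR (- t)) 0 0).
- by rewrite add0r oppr0 expR0; lra.
- by move=> t t0; rewrite mulr_ge0 ?expR_ge0.
- apply: continuous_subspaceT => t; apply: cvgM; first exact: cvg_id.
  by apply: continuous_comp; [exact: oppr_continuous|exact: continuous_expR].
- have h : (- gammaf 1 t - expR (- t)) @[t --> +oo] --> 0.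
    rewrite -[X in _ --> X]subr0 -[X in _ --> X - _]oppr0; apply: cvgB.
      by apply: cvgN; exact: cvg_gammaf.
    exact: cvgr_expR.
  apply: cvg_trans h; apply: near_eq_cvg; near=> t.
  rewrite /gammaf powRr1; first by lra.
  by near: t; apply: nbhs_pinfty_ge; rewrite num_real.
- by move=> t _; exact: ex_derive.
- by apply: cvg_at_right_filter; exact: cF.
- by move=> t _; rewrite derive1E; apply: derive_val.
Unshelve. all: by end_near. Qed.

(** On [[1, 2]] the integrand is at least [expR (- 2)], and that interval has length 1. *)
Lemma Gamma_gt0 p : 0 < p -> 0 < Gamma (p + 1).
Proof.
move=> p0; rewrite GammaE//.
have sub : `[1, 2] `<=` `[(0 : R), +oo[%classic by apply: subset_itv; rewrite bnd_simp.
have mg : measurable_fun `[(0 : R), +oo[ (EFin \o gammaf p).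
  by apply/measurable_EFinP; exact: measurable_gammaf.
apply: (@lt_le_trans _ _ (expR (- 2))); first exact: expR_gt0.
rewrite -lee_fin fineK; last exact: (integrable_fin_num _ (integrable_gammaf p0)).
apply: (@le_trans _ _ (\int[mu]_(t in `[1%R, 2%R]) (gammaf p t)%:E)%E); last first.
  apply: ge0_subset_integral => //.
  by move=> t _; rewrite lee_fin gammaf_ge0.
apply: (@le_trans _ _ (\int[mu]_(t in `[1%R, 2%R]) (expR (- 2))%:E)%E).
  rewrite integral_cst//= lebesgue_measure_itv/= lte_fin ltr1n -EFinB.
  by rewrite -EFinM lee_fin; lra.
apply: ge0_le_integral => //.
  exact: measurable_funS mg.
move=> t /=; rewrite in_itv/= => /andP[t1 t2]; rewrite lee_fin /gammaf.
rewrite -[leLHS]mul1r ler_pM ?ler_expR ?lerN2 ?expR_ge0//.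
by rewrite /powR gt_eqF ?(lt_le_trans _ t1)// -expR0 ler_expR mulr_ge0 ?ln_ge0// ltW.
Qed.

(** * Log-convexity of the gamma function *)

Lemma expR_convex (a b l m : R) : 0 <= l -> 0 <= m -> l + m = 1 ->
  expR (l * a + m * b) <= l * expR a + m * expR b.
Proof.
move=> l0 m0 lm; set c := l * a + m * b.
(* The tangent to the exponential at the barycentre [c] lies below the graph; averaging it at [a]
   and [b] gives [expR c]. *)
have tangent z : expR c * (1 + (z - c)) <= expR z.
  have -> : expR z = expR c * expR (z - c) by rewrite -expRD subrKC.
  by rewrite ler_pM2l ?expR_gt0// expR_ge1Dx.
have e : expR c = l * (expR c * (1 + (a - c))) + m * (expR c * (1 + (b - c))).
  have -> : m = 1 - l by lra.
  by rewrite {3 5}/c (_ : m = 1 - l); [ring|lra].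
by rewrite [leLHS]e lerD// ler_wpM2l.
Qed.

Let conv_gt0 (a b l m : R) : 0 < a -> 0 < b -> 0 <= l -> 0 <= m -> l + m = 1 ->
  0 < l * a + m * b.
Proof.
move=> a0 b0 l0 m0 lm.
have : 0 < m \/ 0 < l by case: (ltP 0 m); [left|right; lra].
by case=> h; nra.
Qed.

(** The pointwise Young inequality behind Hölder's: convexity of the exponential at [a * ln t - A]
    and [b * ln t - B]. The shifts [A] and [B] are free here, to be chosen as the logarithms of the
    two integrals. *)
Lemma gammaf_convex (A B a b l m : R) : 0 < a -> 0 < b -> 0 <= l -> 0 <= m ->
  l + m = 1 -> forall t, 0 <= t -> gammaf (l * a + m * b) t <=
    expR (l * A + m * B) * l * expR (- A) * gammaf a t +
    expR (l * A + m * B) * m * expR (- B) * gammaf b t.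
Proof.
move=> a0 b0 l0 m0 lm t; have c0 := conv_gt0 a0 b0 l0 m0 lm.
rewrite le_eqVlt => /predU1P[<-|t0].
  by rewrite !gammaf0// !mulr0 addr0.
rewrite /gammaf !mulrA -mulrDl ler_pM2r ?expR_gt0//.
rewrite /powR !gt_eqF//.
have h := expR_convex (a * ln t - A) (b * ln t - B) l0 m0 lm.
apply: (@le_trans _ _ (expR (l * A + m * B) *
  expR (l * (a * ln t - A) + m * (b * ln t - B)))).
  by rewrite -expRD ler_expR le_eqVlt; apply/orP; left; apply/eqP; ring.
apply: (le_trans (ler_wpM2l (expR_ge0 _) h)).
rewrite (expRD (a * _)) (expRD (b * _)) le_eqVlt.
by apply/orP; left; apply/eqP; ring.
Qed.

Definition lnGamma1 x : R := ln (Gamma (x + 1)).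

Lemma expR_lnGamma1 x : 0 < x -> expR (lnGamma1 x) = Gamma (x + 1).
Proof. by move=> x0; rewrite lnK// posrE Gamma_gt0. Qed.

Lemma lnGamma1S x : 0 < x -> lnGamma1 (x + 1) = lnGamma1 x + ln (x + 1).
Proof.
move=> x0; rewrite /lnGamma1 -addrA GammaS// lnM ?posrE ?Gamma_gt0//; first lra.
by rewrite addr_gt0.
Qed.

Lemma lnGamma1_1 : lnGamma1 1 = 0.
Proof. by rewrite /lnGamma1 Gamma2 ln1. Qed.

(** With [A] and [B] equal to [lnGamma1 a] and [lnGamma1 b], both normalised integrals are 1, so the
    pointwise bound integrates to [expR (l * A + m * B) * (l + m)]. *)
Lemma lnGamma1_convex (a b l m : R) : 0 < a -> 0 < b -> 0 <= l -> 0 <= m ->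
  l + m = 1 -> lnGamma1 (l * a + m * b) <= l * lnGamma1 a + m * lnGamma1 b.
Proof.
move=> a0 b0 l0 m0 lm; set A := lnGamma1 a; set B := lnGamma1 b.
have c0 := conv_gt0 a0 b0 l0 m0 lm.
set c := l * a + m * b in c0 *.
rewrite -ler_expR expR_lnGamma1//.
have pw := gammaf_convex A B a0 b0 l0 m0 lm.
have ia := @integrableZl _ _ _ mu _ (measurable_itv _)
  (expR (l * A + m * B) * l * expR (- A)) _ (integrable_gammaf a0).
have ib := @integrableZl _ _ _ mu _ (measurable_itv _)
  (expR (l * A + m * B) * m * expR (- B)) _ (integrable_gammaf b0).
have iab : mu.-integrable `[0, +oo[ (EFin \o (fun t =>
    expR (l * A + m * B) * l * expR (- A) * gammaf a t +
    expR (l * A + m * B) * m * expR (- B) * gammaf b t)).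
  have := @integrableD _ _ _ mu _ (measurable_itv _) _ _ ia ib.
  exact: eq_integrable.
rewrite GammaE//.
have /le_trans : \int[mu]_(t in `[0, +oo[) gammaf c t <=
    \int[mu]_(t in `[0, +oo[) (expR (l * A + m * B) * l * expR (- A) * gammaf a t +
    expR (l * A + m * B) * m * expR (- B) * gammaf b t).
  apply: le_Rintegral => //; first exact: integrable_gammaf.
  by move=> t /=; rewrite in_itv/= andbT => /pw; exact.
apply; rewrite RintegralD// RintegralZl//; last exact: integrable_gammaf.
rewrite RintegralZl//; last exact: integrable_gammaf.
rewrite -!GammaE//.
have EA : expR (- A) * Gamma (a + 1) = 1.
  by rewrite -(expR_lnGamma1 a0) -expRD addNr expR0.
have EB : expR (- B) * Gamma (b + 1) = 1.
  by rewrite -(expR_lnGamma1 b0) -expRD addNr expR0.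
move: A B EA EB {pw ia ib iab} => A B.
move: (expR (- A)) (expR (- B)) (expR (l * A + m * B)) => eA eB E EA EB.
rewrite -!mulrA EA EB !mulr1 -mulrDr lm mulr1 lexx //.
Qed.

End gamma_integral.

(** * Logarithm inequalities, monotonicity from derivatives, and derivatives of limits *)

Section general_analysis.
Context {R : realType}.
Implicit Types x y z : R.

Lemma ln_le_sub1 x : 0 < x -> ln x <= x - 1.
Proof. by move=> x0; have := @le_ln1Dx _ (x - 1); rewrite subrKC; apply; lra. Qed.

Lemma ln_ge_1subV x : 0 < x -> 1 - x^-1 <= ln x.
Proof.
move=> x0; have := @ln_le_sub1 x^-1; rewrite invr_gt0 => /(_ x0).
by rewrite lnV ?posrE//; lra.
Qed.

Lemma lnB_le x y : 0 < x -> 0 < y -> ln y - ln x <= (y - x) / x.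
Proof.
move=> x0 y0; rewrite -ln_div ?posrE//.
apply: (le_trans (ln_le_sub1 (divr_gt0 y0 x0))).
by rewrite mulrBl mulfV ?gt_eqF.
Qed.

Lemma lnB_ge x y : 0 < x -> 0 < y -> (y - x) / y <= ln y - ln x.
Proof. by move=> x0 y0; have := lnB_le y0 x0; rewrite !mulrBl; lra. Qed.

Lemma is_derive1_inv x : 0 < x -> is_derive x 1 GRing.inv (- x ^- 2).
Proof.
move=> x0; have x0' : x != 0 by rewrite gt_eqF.
apply: DeriveDef; first exact: (@derivableV _ _ id).
by rewrite (@deriveV _ _ id)// derive_id /GRing.scale/= mulr1.
Qed.

Lemma MVT_derive (f df : R -> R) (a b : R) : a < b ->
  (forall z, a <= z <= b -> is_derive z 1 f (df z)) ->
  exists2 c, a < c < b & f b - f a = df c * (b - a).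
Proof.
move=> ab h.
have [||c] := @MVT R f df a b ab.
- by move=> z; rewrite in_itv/= => /andP[az zb]; apply: h; rewrite !ltW.
- apply: derivable_within_continuous => z; rewrite in_itv/= => /h dz.
  exact: ex_derive.
- by rewrite in_itv/= => ? ?; exists c.
Qed.

Lemma is_derive_le (f df : R -> R) (a b : R) : a <= b ->
  (forall z, a <= z <= b -> is_derive z 1 f (df z)) ->
  (forall z, a <= z <= b -> df z <= 0) -> f b <= f a.
Proof.
rewrite le_eqVlt => /predU1P[->//|ab] h df0.
have [c /andP[ac cb] e] := MVT_derive ab h.
rewrite -subr_le0 e mulr_le0_ge0 ?subr_ge0 ?(ltW ab)//.
by rewrite df0 ?ltW.
Qed.

Lemma is_derive_lt (f df : R -> R) (a b : R) : a < b ->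
  (forall z, a <= z <= b -> is_derive z 1 f (df z)) ->
  (forall z, a <= z <= b -> df z < 0) -> f b < f a.
Proof.
move=> ab h df0.
have [c /andP[ac cb] e] := MVT_derive ab h.
by rewrite -subr_lt0 e nmulr_rlt0 ?subr_gt0// df0 ?ltW.
Qed.

(** The Archimedean property, in the form that lets error terms of order [1 / n] be discarded. *)
Lemma ler0_of_le_divn (a c : R) : (forall n, a <= c / n.+1%:R) -> a <= 0.
Proof.
move=> h; apply/ler_addgt0Pl => e e0; rewrite addr0.
have [c0|c0] := leP c 0.
  apply: (le_trans (h 0%N)); apply: (le_trans _ (ltW e0)).
  by rewrite divr1.
have [n nce] : exists n, c / e < n.+1%:R.
  exists (Num.truncn (c / e)).
  by rewrite truncnS_gt.
apply: (le_trans (h n)); rewrite ler_pdivrMr// ltW//.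
by rewrite mulrC -ltr_pdivrMr.
Qed.

(* Limits may be differentiated term by term as soon as the second order
   remainders are bounded uniformly in [n]. *)
Lemma is_derive_cvgn (F dF : nat -> R -> R) (G : R -> R) (x l K d : R) : 0 < d ->
  (forall y, `|y - x| < d -> F n y @[n --> \oo] --> G y) ->
  dF n x @[n --> \oo] --> l ->
  (forall n y, `|y - x| < d ->
    `|F n y - F n x - dF n x * (y - x)| <= K * (y - x) ^+ 2) ->
  is_derive x 1 G l.
Proof.
move=> d0 FG dFl FK.
have GK y : `|y - x| < d -> `|G y - G x - l * (y - x)| <= K * (y - x) ^+ 2.
  move=> yx.
  have c : `|F n y - F n x - dF n x * (y - x)| @[n --> \oo] -->
      `|G y - G x - l * (y - x)|.
    apply: cvg_norm; apply: cvgB.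
      by apply: cvgB; apply: FG => //; rewrite subrr normr0.
    by apply: cvgM => //; exact: cvg_cst.
  rewrite -(cvg_lim (@norm_hausdorff _ R) c).
  by apply: limr_le; [apply: cvgP c|apply: nearW => n; exact: FK].
have H : (fun h => h^-1 *: ((G \o shift x) h - G x)) @ 0^' --> l.
  apply/cvgrPdist_le => /= e e0.
  (* Whatever the sign of [K], this is a positive bound by which [e] can be divided. *)
  have K0 : 0 < `|K| + 1 by rewrite ltr_wpDl.
  near=> h.
  have h0 : h != 0 by near: h; exact: nbhs_dnbhs_neq.
  have hd : `|h| < d by near: h; apply: dnbhs0_lt.
  have he : `|h| <= e / (`|K| + 1).
    by near: h; apply: dnbhs0_le; rewrite divr_gt0.
  have := GK (h + x); rewrite addrK => /(_ hd).
  set D := G (h + x) - G x => hK.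
  have -> : l - h^-1 *: D = - h^-1 * (D - l * h).
    by rewrite /GRing.scale/=; field.
  rewrite normrM normrN normfV ler_pdivrMl ?normr_gt0//.
  apply: (le_trans hK); rewrite -real_normK ?num_real// expr2 mulrA.
  rewrite mulrC ler_wpM2l//.
  apply: (@le_trans _ _ ((`|K| + 1) * `|h|)).
    by rewrite ler_wpM2r// (le_trans (ler_norm _))// lerDl.
  by rewrite mulrC -ler_pdivlMr.
apply: DeriveDef.
  apply/cvg_ex; exists l => /=.
  apply: cvg_trans H; apply: near_eq_cvg; near=> h.
  by rewrite /GRing.scale/= mulr1.
rewrite /derive; apply: cvg_lim => //.
apply: cvg_trans H; apply: near_eq_cvg; near=> h.
by rewrite /GRing.scale/= mulr1.
Unshelve. all: by end_near. Qed.

End general_analysis.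

Local Ltac nz := repeat (apply/andP; split); apply: lt0r_neq0; lra.

(** * Euler's finite products and the digamma and trigamma functions *)

Section bohr_mollerup_series.
Context {R : realType}.
Implicit Types (x y z : R) (n m : nat).

(* [BM0 n x] is Euler's finite product for [ln (Gamma (x + 1))] with [n.+1]
   factors; [BM1] and [BM2] are its first two derivatives. *)
Definition BM0 n x : R :=
  ln n.+1`!%:R + x * ln n.+1%:R - \sum_(k < n.+1) ln (x + k.+1%:R).
Definition BM1 n x : R := ln n.+1%:R - \sum_(k < n.+1) (x + k.+1%:R)^-1.
Definition BM2 n x : R := \sum_(k < n.+1) (x + k.+1%:R) ^- 2.

(** The digamma and trigamma functions at [x + 1]. For [0 < x] these are genuine limits, by
    [cvg_BM1] and [cvg_BM2]. *)
Definition digamma1 x : R := limn (BM1 ^~ x).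
Definition trigamma1 x : R := limn (BM2 ^~ x).

(** The term [- n.+1%:R^-1] makes the induction close, because [1/u - 1/(u + 1)] exceeds
    [1/(u + 1)^2]. *)
Lemma sum_inv_sqr_le n : \sum_(k < n.+1) (k.+1%:R : R) ^- 2 <= 2 - n.+1%:R^-1.
Proof.
elim: n => [|n ih]; first by rewrite big_ord1 expr1n invr1; lra.
rewrite big_ord_recr/=; apply: (le_trans (lerD ih (lexx _))).
have n1 : (0 : R) < n.+1%:R by rewrite ltr0n.
rewrite -(natr1 n.+1); move: (n.+1%:R : R) n1 => u u0.
rewrite -subr_ge0.
have -> : 2 - (u + 1)^-1 - (2 - u^-1 + (u + 1) ^- 2) = (u * (u + 1) ^+ 2)^-1.
  by field; nz.
by rewrite invr_ge0 mulr_ge0 ?sqr_ge0 ?(ltW u0).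
Qed.

Lemma natS_gt0 n : (0 : R) < n.+1%:R. Proof. by rewrite ltr0n. Qed.

Let xk_gt0 x n : 0 < x -> 0 < x + n.+1%:R.
Proof. by move=> x0; have := natS_gt0 n; lra. Qed.

Lemma ler_norm_sum_sqr n (a : 'I_n.+1 -> R) (d : R) :
  (forall k, `|a k| <= d ^+ 2 * k.+1%:R ^- 2) -> `|\sum_(k < n.+1) a k| <= 2 * d ^+ 2.
Proof.
move=> h; apply: (le_trans (ler_norm_sum _ _ _)).
apply: (@le_trans _ _ (\sum_(k < n.+1) d ^+ 2 * k.+1%:R ^- 2)).
  by apply: ler_sum => k _; exact: h.
rewrite -mulr_sumr mulrC ler_wpM2r ?sqr_ge0//.
apply: (le_trans (sum_inv_sqr_le n)).
by rewrite lerBlDr lerDl invr_ge0 ler0n.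
Qed.

Let inv_mul_le x y n : 0 < x -> 0 < y ->
  ((x + n.+1%:R) * (y + n.+1%:R))^-1 <= n.+1%:R ^- 2.
Proof.
move=> x0 y0; have u0 := natS_gt0 n.
rewrite lef_pV2 ?posrE ?mulr_gt0 ?exprn_gt0 ?addr_gt0//.
by rewrite expr2 ler_pM// ?lerDr ltW.
Qed.

(** Each logarithm lies below its tangent by at most [(y - x)^2 / ((x + k + 1) * (y + k + 1))], and
    these gaps sum to at most [2 * (y - x)^2], uniformly in [n]. *)
Lemma BM0_taylor n x y : 0 < x -> 0 < y ->
  `|BM0 n y - BM0 n x - BM1 n x * (y - x)| <= 2 * (y - x) ^+ 2.
Proof.
move=> x0 y0.
have -> : BM0 n y - BM0 n x - BM1 n x * (y - x) = \sum_(k < n.+1)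
    - (ln (y + k.+1%:R) - ln (x + k.+1%:R) - (y - x) / (x + k.+1%:R)).
  rewrite sumrN !sumrB -mulr_sumr /BM0 /BM1; ring.
apply: ler_norm_sum_sqr => k; rewrite normrN.
have xk := xk_gt0 k x0; have yk := xk_gt0 k y0.
have /= := lnB_le xk yk; have /= := lnB_ge xk yk.
have -> : y + k.+1%:R - (x + k.+1%:R) = y - x by ring.
move=> h1 h2.
apply: (@le_trans _ _ ((y - x) ^+ 2 * ((x + k.+1%:R) * (y + k.+1%:R))^-1)).
  rewrite ler0_norm; last by lra.
  have -> : (y - x) ^+ 2 * ((x + k.+1%:R) * (y + k.+1%:R))^-1 =
    (y - x) / (x + k.+1%:R) - (y - x) / (y + k.+1%:R).
    by field; nz.
  lra.
by rewrite ler_wpM2l ?sqr_ge0// inv_mul_le.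
Qed.

Lemma BM1_taylor n x y : 0 < x -> 0 < y ->
  `|BM1 n y - BM1 n x - BM2 n x * (y - x)| <= 2 * (y - x) ^+ 2.
Proof.
move=> x0 y0.
have -> : BM1 n y - BM1 n x - BM2 n x * (y - x) = \sum_(k < n.+1)
    - ((y - x) ^+ 2 * ((x + k.+1%:R) * (y + k.+1%:R))^-1 * (x + k.+1%:R)^-1).
  rewrite (eq_bigr (fun k : 'I_n.+1 => (x + k.+1%:R)^-1 - (y + k.+1%:R)^-1 -
      (y - x) * (x + k.+1%:R) ^- 2)).
    rewrite !sumrB -mulr_sumr /BM2 /BM1; ring.
  move=> k _; have xk := xk_gt0 k x0; have yk := xk_gt0 k y0.
  by field; nz.
apply: ler_norm_sum_sqr => k; rewrite normrN.
have xk := xk_gt0 k x0; have yk := xk_gt0 k y0.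
rewrite ger0_norm; last first.
  by rewrite !divr_ge0 ?sqr_ge0 ?(ltW xk)// mulr_ge0 ?(ltW xk) ?(ltW yk).
rewrite -mulrA ler_wpM2l ?sqr_ge0//.
apply: (le_trans _ (inv_mul_le k x0 y0)).
rewrite ler_piMr ?invr_ge0 ?mulr_ge0 ?(ltW xk) ?(ltW yk)//.
have k1 : (1 : R) <= k.+1%:R by rewrite ler1n.
by rewrite invf_le1//; lra.
Qed.

(** Comparison of the sum with the integral of [1/t], done term by term with [lnB_le]. *)
Lemma sum_inv_ge n x : 0 < x ->
  ln (x + n.+1%:R) - ln (x + 1) <= \sum_(k < n) (x + k.+1%:R)^-1.
Proof.
move=> x0; elim: n => [|n ih]; first by rewrite big_ord0 subrr.
rewrite big_ord_recr/=.
have := lnB_le (xk_gt0 n x0) (xk_gt0 n.+1 x0).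
rewrite (_ : (x + n.+2%:R - (x + n.+1%:R)) = 1) ?div1r; last first.
  by rewrite -(natr1 n.+1); ring.
by move: ih; lra.
Qed.

Lemma sum_inv_le n x : 0 < x ->
  \sum_(k < n) (x + k.+1%:R)^-1 <= ln (x + n%:R) - ln x.
Proof.
move=> x0; elim: n => [|n ih]; first by rewrite big_ord0 addr0 subrr.
rewrite big_ord_recr/=.
have xn : 0 < x + n%:R by rewrite ltr_wpDr ?ler0n.
have := lnB_ge xn (xk_gt0 n x0).
rewrite (_ : (x + n.+1%:R - (x + n%:R)) = 1) ?div1r; last first.
  by rewrite -(natr1 n); ring.
by move: ih; lra.
Qed.

Lemma BM1_le n x : 0 < x -> BM1 n x <= ln (x + 1).
Proof.
move=> x0; have := sum_inv_ge n.+1 x0; rewrite /BM1.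
have : ln n.+1%:R <= ln (x + n.+2%:R).
  by rewrite ler_ln ?posrE ?natS_gt0 ?xk_gt0// -(natr1 n.+1); lra.
by lra.
Qed.

Lemma BM1_ge n x : 0 < x -> ln x - x / n.+1%:R <= BM1 n x.
Proof.
move=> x0; have := sum_inv_le n.+1 x0; rewrite /BM1.
have := lnB_le (natS_gt0 n) (xk_gt0 n x0); rewrite addrK; move: (x / _) => v; lra.
Qed.

Lemma nondecreasing_BM1 x : 0 < x -> nondecreasing_seq (BM1 ^~ x).
Proof.
move=> x0; apply/nondecreasing_seqP => n.
rewrite /BM1 (big_ord_recr n.+1)/=.
have := lnB_ge (natS_gt0 n) (natS_gt0 n.+1).
rewrite (_ : (n.+2%:R - n.+1%:R) = 1 :> R) ?div1r; last by rewrite -(natr1 n.+1); ring.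
have : (x + n.+2%:R)^-1 <= n.+2%:R^-1.
  by rewrite lef_pV2 ?posrE ?xk_gt0 ?natS_gt0// lerDr ltW.
by move: (n.+2%:R^-1) ((x + n.+2%:R)^-1) => a b; lra.
Qed.

Lemma cvg_BM1 x : 0 < x -> BM1 n x @[n --> \oo] --> digamma1 x.
Proof.
move=> x0; apply: nondecreasing_is_cvgn; first exact: nondecreasing_BM1.
by exists (ln (x + 1)) => _ [n _ <-]; exact: BM1_le.
Qed.

Lemma digamma1_le x : 0 < x -> digamma1 x <= ln (x + 1).
Proof.
move=> x0; apply: limr_le; first by apply: cvgP; exact: cvg_BM1.
by apply: nearW => n; exact: BM1_le.
Qed.

Lemma digamma1_ge x : 0 < x -> ln x <= digamma1 x.
Proof.
move=> x0; rewrite -subr_le0; apply: (@ler0_of_le_divn _ _ x) => n.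
have : BM1 n x <= digamma1 x.
  apply: nondecreasing_cvgn_le; first exact: nondecreasing_BM1.
  by apply: cvgP; exact: cvg_BM1.
by have := BM1_ge n x0; move: (x / _) => v; lra.
Qed.

Lemma BM2_le n x : 0 < x ->
  BM2 n x <= x^-1 - x ^- 2 / 2 + x ^- 3 / 6.
Proof.
move=> x0.
(* The start of the asymptotic series of trigamma: [q z - q (z + 1)] exceeds [(z + 1)^-2] by exactly
   [1 / (6 * (z * (z + 1))^3)], so the sum telescopes. *)
pose q z : R := z^-1 - z ^- 2 / 2 + z ^- 3 / 6.
have qS z : 0 < z -> (z + 1) ^- 2 <= q z - q (z + 1).
  move=> z0; rewrite -subr_ge0.
  have -> : q z - q (z + 1) - (z + 1) ^- 2 = (6 * (z * (z + 1)) ^+ 3)^-1.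
    by rewrite /q; field; nz.
  by rewrite invr_ge0 mulr_ge0// exprn_ge0// mulr_ge0; lra.
have q0 z : 0 < z -> 0 <= q z.
  move=> z0; have -> : q z = (6 * z ^+ 2 - 3 * z + 1) / (6 * z ^+ 3).
    by rewrite /q; field; nz.
  apply: divr_ge0; last by rewrite mulr_ge0// exprn_ge0// ltW.
  by nra.
have main m : \sum_(k < m) (x + k.+1%:R) ^- 2 <= q x - q (x + m%:R).
  elim: m => [|m ih]; first by rewrite big_ord0 addr0 subrr.
  rewrite big_ord_recr/=.
  have xm : 0 < x + m%:R by rewrite ltr_wpDr ?ler0n.
  rewrite (_ : x + m.+1%:R = x + m%:R + 1); last by rewrite -natr1 addrA.
  by have := qS _ xm; move: ih; lra.
have := main n.+1; have := q0 _ (xk_gt0 n x0); rewrite -/(BM2 n x) -/(q x); lra.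
Qed.

Lemma BM2_ge n x : 0 < x ->
  x^-1 - x ^- 2 / 2 - n.+1%:R^-1 <= BM2 n x.
Proof.
move=> x0.
(* With one term fewer the defect [1 / (2 * (z * (z + 1))^2)] has the opposite sign, which gives a
   lower bound. *)
pose q z : R := z^-1 - z ^- 2 / 2.
have qS z : 0 < z -> q z - q (z + 1) <= (z + 1) ^- 2.
  move=> z0; rewrite -subr_ge0.
  have -> : (z + 1) ^- 2 - (q z - q (z + 1)) = (2 * (z * (z + 1)) ^+ 2)^-1.
    by rewrite /q; field; nz.
  by rewrite invr_ge0 mulr_ge0// exprn_ge0// mulr_ge0; lra.
have main m : q x - q (x + m%:R) <= \sum_(k < m) (x + k.+1%:R) ^- 2.
  elim: m => [|m ih]; first by rewrite big_ord0 addr0 subrr.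
  rewrite big_ord_recr/=.
  have xm : 0 < x + m%:R by rewrite ltr_wpDr ?ler0n.
  rewrite (_ : x + m.+1%:R = x + m%:R + 1); last by rewrite -natr1 addrA.
  by have := qS _ xm; move: ih; lra.
have : q (x + n.+1%:R) <= n.+1%:R^-1.
  apply: (@le_trans _ _ (x + n.+1%:R)^-1).
    by rewrite /q lerBlDr lerDl divr_ge0// invr_ge0 sqr_ge0.
  by rewrite lef_pV2 ?posrE ?xk_gt0 ?natS_gt0// lerDr ltW.
by have := main n.+1; rewrite -/(BM2 n x) -/(q x); move: (n.+1%:R^-1) => v; lra.
Qed.

Lemma nondecreasing_BM2 x : nondecreasing_seq (BM2 ^~ x).
Proof.
apply/nondecreasing_seqP => n; rewrite /BM2 (big_ord_recr n.+1)/= lerDl.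
by rewrite invr_ge0 sqr_ge0.
Qed.

Lemma cvg_BM2 x : 0 < x -> BM2 n x @[n --> \oo] --> trigamma1 x.
Proof.
move=> x0; apply: nondecreasing_is_cvgn; first exact: nondecreasing_BM2.
by exists (x^-1 - x ^- 2 / 2 + x ^- 3 / 6) => _ [n _ <-]; exact: BM2_le.
Qed.

Lemma trigamma1_le x : 0 < x -> trigamma1 x <= x^-1 - x ^- 2 / 2 + x ^- 3 / 6.
Proof.
move=> x0; apply: limr_le; first by apply: cvgP; exact: cvg_BM2.
by apply: nearW => n; exact: BM2_le.
Qed.

Lemma trigamma1_ge x : 0 < x -> x^-1 - x ^- 2 / 2 <= trigamma1 x.
Proof.
move=> x0; rewrite -subr_le0; apply: (@ler0_of_le_divn _ _ 1) => n.
have : BM2 n x <= trigamma1 x.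
  apply: nondecreasing_cvgn_le; first exact: nondecreasing_BM2.
  by apply: cvgP; exact: cvg_BM2.
by have := BM2_ge n x0; rewrite div1r; move: (n.+1%:R^-1) => v; lra.
Qed.

(** * Derivative of digamma and its sharp bounds *)

Let near_gt0 x y : `|y - x| < x -> 0 < y.
Proof. by rewrite ltr_distl subrr => /andP[]. Qed.

Lemma is_derive_digamma1 x : 0 < x -> is_derive x 1 digamma1 (trigamma1 x).
Proof.
move=> x0; apply: (@is_derive_cvgn _ BM1 BM2 digamma1 x (trigamma1 x) 2 x x0).
- by move=> y /near_gt0; exact: cvg_BM1.
- exact: cvg_BM2.
- by move=> n y /near_gt0 y0; exact: BM1_taylor.
Qed.

(** The difference [g] of the two sides is nonincreasing by [trigamma1_le]. At [x + n.+1%:R] the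
    crude bound [digamma1_ge] keeps it above [- 1 / (2 * n.+1%:R)], so [g] is nonnegative. *)
Lemma digamma1_lower x : 0 < x -> ln x + x^-1 / 2 - x ^- 2 / 12 <= digamma1 x.
Proof.
move=> x0; rewrite -subr_le0; apply: (@ler0_of_le_divn _ _ (1 / 2)) => n.
pose g z : R := digamma1 z - (ln z + z^-1 / 2 - z^-1 ^+ 2 / 12).
have dg z : 0 < z -> is_derive z 1 g (trigamma1 z - (z^-1 - z ^- 2 / 2 + z ^- 3 / 6)).
  move=> z0; have := is_derive_digamma1 z0 => d1; have := is_derive1_ln z0 => d2.
  have := is_derive1_inv z0 => d3.
  rewrite /g; apply: is_derive_eq; rewrite /GRing.scale/=; field; nz.
have xn := xk_gt0 n x0; have n0 := natS_gt0 n.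
have zx z : x <= z <= x + n.+1%:R -> 0 < z by move=> /andP[/(lt_le_trans x0)].
have : g (x + n.+1%:R) <= g x.
  apply: (is_derive_le _ (fun z h => dg z (zx z h))); first by lra.
  by move=> z /zx /trigamma1_le; lra.
rewrite /g !exprVn; have := digamma1_ge xn.
have : (x + n.+1%:R)^-1 <= n.+1%:R^-1 by rewrite lef_pV2 ?posrE//; lra.
have : 0 <= (x + n.+1%:R) ^- 2 by rewrite invr_ge0 sqr_ge0.
by move: ((x + n.+1%:R) ^- 2) ((x + n.+1%:R)^-1) (n.+1%:R^-1) => u v w; lra.
Qed.

(** The same descent from infinity, now with [trigamma1_ge] for monotonicity and [digamma1_le] far
    out. *)
Lemma digamma1_upper x : 0 < x -> digamma1 x <= ln x + x^-1 / 2.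
Proof.
move=> x0; rewrite -subr_le0; apply: (@ler0_of_le_divn _ _ 1) => n.
pose g z : R := ln z + z^-1 / 2 - digamma1 z.
have dg z : 0 < z -> is_derive z 1 g (z^-1 - z ^- 2 / 2 - trigamma1 z).
  move=> z0; have := is_derive_digamma1 z0 => d1; have := is_derive1_ln z0 => d2.
  have := is_derive1_inv z0 => d3.
  rewrite /g; apply: is_derive_eq; rewrite /GRing.scale/=; field; nz.
have xn := xk_gt0 n x0; have n0 := natS_gt0 n.
have zx z : x <= z <= x + n.+1%:R -> 0 < z by move=> /andP[/(lt_le_trans x0)].
have : g (x + n.+1%:R) <= g x.
  apply: (is_derive_le _ (fun z h => dg z (zx z h))); first by lra.
  by move=> z /zx /trigamma1_ge; lra.
rewrite /g; have := digamma1_le xn.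
have xn1 : 0 < x + n.+1%:R + 1 by lra.
have := lnB_le xn xn1.
rewrite (_ : x + n.+1%:R + 1 - (x + n.+1%:R) = 1); last by ring.
have : (x + n.+1%:R)^-1 <= n.+1%:R^-1 by rewrite lef_pV2 ?posrE//; lra.
have : 0 <= (x + n.+1%:R)^-1 by rewrite invr_ge0 ltW.
by rewrite !div1r; move: ((x + n.+1%:R)^-1) (n.+1%:R^-1) => v w; lra.
Qed.

End bohr_mollerup_series.

(** * The Bohr-Mollerup argument and Stirling bounds *)

Section bohr_mollerup.
Context {R : realType}.
Variable f : R -> R.
Hypothesis fS : forall x, 0 < x -> f (x + 1) = f x + ln (x + 1).
Hypothesis f1 : f 1 = 0.
Hypothesis f_convex : forall a b l m : R, 0 < a -> 0 < b -> 0 <= l -> 0 <= m ->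
  l + m = 1 -> f (l * a + m * b) <= l * f a + m * f b.
Implicit Types (x y z : R) (n m : nat).

Lemma three_slopes (a b c : R) : 0 < a -> a < b -> b < c ->
  (f b - f a) * (c - b) <= (f c - f b) * (b - a).
Proof.
move=> a0 ab bc; have ca : 0 < c - a by lra.
have ca0 : c - a != 0 by rewrite gt_eqF.
have := @f_convex a c ((c - b) / (c - a)) ((b - a) / (c - a)) a0.
rewrite -mulrDl (_ : c - b + (b - a) = c - a); last by ring.
rewrite (_ : _ * a + _ * c = b); last by field.
rewrite divff// => /(_ _ _ _ erefl) h.
have {h} : f b <= (c - b) / (c - a) * f a + (b - a) / (c - a) * f c.
  by apply: h; [lra|apply: divr_ge0; lra|apply: divr_ge0; lra].
rewrite -(ler_pM2l ca) (_ : (c - a) * (_ + _) = (c - b) * f a + (b - a) * f c).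
  by move: (f a) (f b) (f c) => u v w; lra.
by field.
Qed.

Lemma bm_addn m x : 0 < x -> f (x + m%:R) = f x + \sum_(k < m) ln (x + k.+1%:R).
Proof.
move=> x0; elim: m => [|m ih]; first by rewrite big_ord0 !addr0.
rewrite big_ord_recr/= addrA -ih -natr1 addrA fS// ltr_wpDr ?ler0n//.
Qed.

Lemma bm_nat m : f m.+1%:R = ln m.+1`!%:R.
Proof.
elim: m => [|m ih]; first by rewrite f1 (_ : 1`! = 1)%N ?ln1.
rewrite -natr1 fS ?natS_gt0// ih natr1 (factS m.+1) natrM lnM ?posrE ?ltr0n ?fact_gt0//.
by rewrite addrC.
Qed.

(** Compares the slope of [f] over [[n + 1, x + n + 1]] with the slopes over the adjacent unit
    intervals, which are [ln (n + 1)] and [ln (x + n + 2)]. The condition [0 < n] keeps the left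
    endpoint [n] where [f] is known to be convex. *)
Lemma BM0_bounds n x : (0 < n)%N -> 0 < x ->
  f x - x * (x + 1) * n.+1%:R^-1 <= BM0 n x <= f x.
Proof.
move=> n0 x0.
have N0 : (0 : R) < n%:R by rewrite ltr0n.
have e := bm_addn n.+1 x0.
have eN := bm_nat n.
have eS : f n.+1%:R = f n%:R + ln n.+1%:R by rewrite -natr1 fS.
rewrite /BM0 -eN.
have Nx0 : 0 < x + n.+1%:R by have := natS_gt0 (R := R) n; lra.
have h1 := @three_slopes n%:R n.+1%:R (x + n.+1%:R) N0.
have {}h1 : (f n.+1%:R - f n%:R) * (x + n.+1%:R - n.+1%:R) <=
    (f (x + n.+1%:R) - f n.+1%:R) * (n.+1%:R - n%:R).
  by apply: h1; [rewrite ltr_nat|lra].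
have h2 := @three_slopes n.+1%:R (x + n.+1%:R) (x + n.+1%:R + 1) (natS_gt0 n).
have {}h2 : (f (x + n.+1%:R) - f n.+1%:R) * (x + n.+1%:R + 1 - (x + n.+1%:R)) <=
    (f (x + n.+1%:R + 1) - f (x + n.+1%:R)) * (x + n.+1%:R - n.+1%:R).
  by apply: h2; lra.
have Nx1 : 0 < x + n.+1%:R + 1 by lra.
have h3 := lnB_le (natS_gt0 n) Nx1.
rewrite (_ : x + n.+1%:R + 1 - n.+1%:R = x + 1) in h3; last by ring.
have h4 := ler_wpM2l (ltW x0) h3.
rewrite fS// in h2.
rewrite (_ : x + n.+1%:R + 1 - (x + n.+1%:R) = 1) in h2; last by ring.
rewrite addrK in h1 h2.
rewrite (_ : n.+1%:R - n%:R = 1 :> R) in h1; last by rewrite -natr1; ring.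
rewrite mulrA in h4.
move: e eS h1 h2 h4.
move: (f (x + n.+1%:R)) (ln (x + n.+1%:R + 1)) (ln n.+1%:R) (n.+1%:R^-1) (f n.+1%:R) (f n%:R).
move=> F L l v A B; move: (\sum_(k < n.+1) _) => S -> -> h1 h2 h4.
by apply/andP; split; lra.
Qed.

Lemma cvg_BM0 x : 0 < x -> BM0 n x @[n --> \oo] --> f x.
Proof.
move=> x0.
apply: (@squeeze_cvgr _ _ _ _ (fun n => f x - x * (x + 1) * n.+1%:R^-1) (cst (f x))).
- near=> n; apply: BM0_bounds => //; by near: n; exact: nbhs_infty_gt.
- rewrite -[X in _ --> X]subr0 -[X in _ --> _ - X](mulr0 (x * (x + 1))).
  apply: cvgB; first exact: cvg_cst.
  by apply: cvgM; [exact: cvg_cst|exact: cvg_harmonic].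
- exact: cvg_cst.
Unshelve. all: by end_near. Qed.

Lemma is_derive_bm x : 0 < x -> is_derive x 1 f (digamma1 x).
Proof.
move=> x0; have near_gt0 y : `|y - x| < x -> 0 < y.
  by rewrite ltr_distl subrr => /andP[].
apply: (@is_derive_cvgn _ BM0 BM1 f x (digamma1 x) 2 x x0).
- by move=> y /near_gt0; exact: cvg_BM0.
- exact: cvg_BM1.
- by move=> n y /near_gt0 y0; exact: BM0_taylor.
Qed.

(** The middle expression [g] equals 1 at 1. It decreases by [digamma1_upper], while
    [g z - z^-1 / 12] increases by [digamma1_lower], so the total loss is at most 1/12. *)
Lemma stirling_bounds x : 1 <= x ->
  11 / 12 <= f x - (x * ln x - x + ln x / 2) <= 1.
Proof.
move=> x1.
pose g z : R := f z - (z * ln z - z + ln z / 2).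
have dg z : 0 < z -> is_derive z 1 g (digamma1 z - (ln z + z^-1 / 2)).
  move=> z0; have := is_derive_bm z0 => d1; have := is_derive1_ln z0 => d2.
  rewrite /g; apply: is_derive_eq; rewrite /GRing.scale/=; field; apply: lt0r_neq0; lra.
pose k z : R := z^-1 / 12 - g z.
have dk z : 0 < z -> is_derive z 1 k (- (z ^- 2 / 12) - (digamma1 z - (ln z + z^-1 / 2))).
  move=> z0; have := dg z z0 => d1; have := is_derive1_inv z0 => d2.
  by rewrite /k; apply: is_derive_eq; rewrite /GRing.scale/=; field; apply: lt0r_neq0; lra.
have zx z : 1 <= z <= x -> 0 < z by move=> /andP[/(lt_le_trans ltr01)].
have g1 : g 1 = 1 by rewrite /g ln1 f1; lra.
have : g x <= g 1.
  apply: (is_derive_le x1 (fun z h => dg z (zx z h))).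
  by move=> z /zx /digamma1_upper; lra.
have : k x <= k 1.
  apply: (is_derive_le x1 (fun z h => dk z (zx z h))).
  by move=> z /zx /digamma1_lower; lra.
rewrite /k g1 invr1 -/(g x).
have : 0 <= x^-1 by rewrite invr_ge0; lra.
by move=> ? ? ?; apply/andP; split; lra.
Qed.

End bohr_mollerup.

(** * Strict decrease and asymptotics of the derivative of [expR (f x / x)] *)

Section root_concavity.
Context {R : realType}.
Variables f psi tri : R -> R.
Hypothesis df : forall x : R, 0 < x -> is_derive x 1 f (psi x).
Hypothesis dpsi : forall x : R, 0 < x -> is_derive x 1 psi (tri x).
Hypothesis tri_le : forall x : R, 0 < x -> tri x <= x^-1 - x ^- 2 / 2 + x ^- 3 / 6.
Hypothesis psi_ge : forall x : R, 0 < x -> ln x + x^-1 / 2 - x ^- 2 / 12 <= psi x.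
Hypothesis psi_le : forall x : R, 0 < x -> psi x <= ln x + x^-1 / 2.
Hypothesis f_stirling : forall x : R, 1 <= x ->
  11 / 12 <= f x - (x * ln x - x + ln x / 2) <= 1.
Implicit Types x y : R.

Definition xroot x : R := expR (f x / x).
Definition xroot1 x : R := xroot x * (psi x - f x / x) / x.
(** The logarithm of [expR 1 * xroot x / x]: the relative error in the approximation of [xroot x] by
    [x / e]. *)
Definition stirling_eps x : R := f x / x - ln x + 1.

Lemma is_derive_xroot x : 0 < x -> is_derive x 1 xroot (xroot1 x).
Proof.
move=> x0; have := df x0 => d1; have := is_derive1_inv x0 => d2.
rewrite /xroot; apply: is_derive_eq; rewrite /xroot1 /xroot /GRing.scale/=.
by move: (expR _) => E; field; rewrite gt_eqF.
Qed.

Lemma is_derive_xroot1 x : 0 < x -> is_derive x 1 xroot1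
  (xroot x / x ^+ 2 * (x * tri x - 1 + (1 - (psi x - f x / x)) ^+ 2)).
Proof.
move=> x0; have := df x0 => d1; have := is_derive1_inv x0 => d2.
have := dpsi x0 => d3; have := is_derive_xroot x0 => d4.
rewrite /xroot1; apply: is_derive_eq; rewrite /xroot1 /GRing.scale/=.
by move: (xroot x) => E; field; rewrite gt_eqF.
Qed.

Lemma stirling_eps_bounds x : 1 <= x ->
  (ln x / 2 + 11 / 12) / x <= stirling_eps x <= (ln x / 2 + 1) / x.
Proof.
move=> x1; have x0 : 0 < x by lra.
have -> : stirling_eps x = (f x - x * ln x + x) / x by rewrite /stirling_eps; field; rewrite gt_eqF.
have /andP[h1 h2] := f_stirling x1.
by rewrite !ler_pM2r ?invr_gt0//; apply/andP; split; lra.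
Qed.

Lemma slope_bounds x : 0 < x -> stirling_eps x - x^-1 / 2 <= 1 - (psi x - f x / x) <=
  stirling_eps x - x^-1 / 2 + x ^- 2 / 12.
Proof.
move=> x0; have := psi_ge x0; have := psi_le x0; rewrite /stirling_eps.
by move=> ? ?; apply/andP; split; lra.
Qed.

(* The tangent of [ln] at [3 / 2], taken at [sqrt x]. *)
Lemma sqr_ln_lt x : 2 <= x -> (ln x + 1 + x^-1 / 6) ^+ 2 < 2 * x - 2 / 3.
Proof.
move=> x2; have x0 : 0 < x by lra.
set y := Num.sqrt x; have y0 : 0 < y by rewrite sqrtr_gt0.
have yx : x = y ^+ 2 by rewrite sqr_sqrtr// ltW.
have l32 : ln (3 / 2 : R) <= 42 / 100.
  rewrite -ler_expR lnK ?posrE; last by lra.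
  (* Bernoulli's bound is too weak at 0.42, but at 0.0525 it gives 1.0525, whose eighth power
     exceeds 3/2; the power is reached by three squarings. *)
  have -> : 42 / 100 = 8%:R * (525 / 10000) :> R by lra.
  rewrite expRM_natl.
  have := expR_ge1Dx (525 / 10000 : R).
  move: (expR _) => E hE.
  have -> : E ^+ 8 = ((E ^+ 2) ^+ 2) ^+ 2 by rewrite -!exprM.
  have h2 : 1107 / 1000 <= E ^+ 2 by nra.
  have h4 : 1225 / 1000 <= (E ^+ 2) ^+ 2 by move: (E ^+ 2) h2 => F; nra.
  by move: ((E ^+ 2) ^+ 2) h4 => F; nra.
have y14 : 14 / 10 <= y by nra.
have lx : ln x <= 4 / 3 * y - 116 / 100.
  have c0 : (0 : R) < 3 / 2 by lra.
  by rewrite yx lnXn// mulr2n; have := lnB_le c0 y0; lra.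
have ix : x^-1 <= 1 / 2.
  by rewrite -[leRHS]invrK lef_pV2 ?posrE//; lra.
have ix0 : 0 < x^-1 by rewrite invr_gt0.
have lx0 : 0 <= ln x by apply: ln_ge0; lra.
(* The constant is [- 116 / 100 + 1 + 1 / 12], the last term bounding [x^-1 / 6]. *)
apply: (@le_lt_trans _ _ ((4 / 3 * y - 23 / 300) ^+ 2)).
  by rewrite lerXn2r ?nnegrE; lra.
by rewrite [in ltRHS]yx; nra.
Qed.

(** In the sign factor of the second derivative, [z * tri z - 1] is at most
    [- z^-1 / 2 + z ^- 2 / 6], and [sqr_ln_lt] places the square strictly below the opposite of this
    bound. *)
Lemma xroot1_decreasing x y : 2 <= x -> x < y -> xroot1 y < xroot1 x.
Proof.
move=> x2 xy.
have zx z : x <= z <= y -> 2 <= z by move=> /andP[/(le_trans x2)].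
have z0 z : x <= z <= y -> 0 < z by move=> /zx; lra.
apply: (is_derive_lt xy (fun z h => is_derive_xroot1 (z0 z h))) => z h.
have {}x2 := zx z h; have {}z0 := z0 z h; have z1 : 1 <= z by lra.
rewrite pmulr_rlt0; last by rewrite divr_gt0 ?expR_gt0 ?exprn_gt0.
have /andP[s1 s2] := slope_bounds z0.
have /andP[e1 e2] := stirling_eps_bounds z1.
have lz0 : 0 <= ln z by apply: ln_ge0.
set v := 1 - _ in s1 s2 *.
(* Nonnegativity allows the upper bound on [v] to be squared. *)
have v0 : 0 <= v.
  apply: le_trans s1; apply: (@le_trans _ _ ((ln z / 2 + 11 / 12) / z - z^-1 / 2)); last by lra.
  have -> : (ln z / 2 + 11 / 12) / z - z^-1 / 2 = (ln z / 2 + 5 / 12) / z.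
    by field; rewrite gt_eqF.
  by apply: divr_ge0; lra.
have vw : v <= (ln z + 1 + z^-1 / 6) / (2 * z).
  have -> : (ln z + 1 + z^-1 / 6) / (2 * z) = (ln z / 2 + 1) / z - z^-1 / 2 + z ^- 2 / 12.
    by field; rewrite gt_eqF.
  by lra.
have v2 : v ^+ 2 < z^-1 / 2 - z ^- 2 / 6.
  apply: (@le_lt_trans _ _ (((ln z + 1 + z^-1 / 6) / (2 * z)) ^+ 2)).
    by rewrite lerXn2r ?nnegrE//; exact: le_trans vw.
  have -> : z^-1 / 2 - z ^- 2 / 6 = (2 * z - 2 / 3) / (2 * z) ^+ 2.
    by field; rewrite gt_eqF.
  rewrite expr_div_n ltr_pM2r ?invr_gt0 ?exprn_gt0 ?mulr_gt0//.
  exact: sqr_ln_lt.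
have zt : z * tri z <= 1 - z^-1 / 2 + z ^- 2 / 6.
  have -> : 1 - z^-1 / 2 + z ^- 2 / 6 = z * (z^-1 - z ^- 2 / 2 + z ^- 3 / 6).
    by field; rewrite gt_eqF.
  by rewrite ler_pM2l// tri_le.
by lra.
Qed.

Lemma expR1_xroot1E x : 0 < x -> expR 1 * xroot1 x = expR (stirling_eps x) * (psi x - f x / x).
Proof.
move=> x0; rewrite /stirling_eps 2!expRD expRN lnK ?posrE// /xroot1 /xroot.
by move: (expR (_ / _)) (expR 1) => E e; field; rewrite gt_eqF.
Qed.

Lemma stirling_eps_le x : 1 <= x -> [/\ 0 <= stirling_eps x, stirling_eps x <= 1,
  stirling_eps x <= 2 / Num.sqrt x & x * stirling_eps x ^+ 2 <= 4 / Num.sqrt x].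
Proof.
move=> x1; have x0 : 0 < x by lra.
have /andP[e1 e2] := stirling_eps_bounds x1.
have lx0 : 0 <= ln x by apply: ln_ge0.
have ep0 : 0 <= stirling_eps x by apply: le_trans e1; apply: divr_ge0; lra.
set r := Num.sqrt x; have r0 : 0 < r by rewrite sqrtr_gt0.
have rx : x = r ^+ 2 by rewrite sqr_sqrtr// ltW.
(* With [q] the fourth root of [x], [ln x = 4 * ln q <= 4 * (q - 1)]; hence the error is at most
   [2 / q ^+ 3], small enough that even [x] times its square tends to 0. *)
set q := Num.sqrt r; have q0 : 0 < q by rewrite sqrtr_gt0.
have qr : r = q ^+ 2 by rewrite sqr_sqrtr// ltW.
have qx : x = q ^+ 4 by rewrite rx qr -exprM.
have q1 : 1 <= q by rewrite -(@ler_pXn2r _ 4) ?nnegrE ?(ltW q0)// expr1n -qx.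
have lq : ln x / 2 + 1 <= 2 * q.
  by rewrite qx lnXn// -mulr_natl; have := ln_le_sub1 q0; lra.
have e3 : stirling_eps x <= 2 / q ^+ 3.
  apply: (le_trans e2); rewrite ler_pdivrMr// [in leRHS]qx.
  have -> : 2 / q ^+ 3 * q ^+ 4 = 2 * q by field; rewrite gt_eqF.
  exact: lq.
split => //.
- apply: (le_trans e2); rewrite ler_pdivrMr// mul1r.
  by have := ln_le_sub1 x0; lra.
- apply: (le_trans e3); rewrite qr ler_pM2l// lef_pV2 ?posrE ?exprn_gt0//.
  exact: ler_weXn2l.
- apply: (@le_trans _ _ (x * (2 / q ^+ 3) ^+ 2)).
    by rewrite ler_pM2l// lerXn2r ?nnegrE// (le_trans ep0).
  by rewrite qx qr le_eqVlt; apply/orP; left; apply/eqP; field; rewrite gt_eqF.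
Qed.

(** Writing [eps] for [stirling_eps x], the quantity is [(expR eps * u - 1) * x] with [u] close to
    [1 - eps + x^-1 / 2]. The upper bound uses [expR eps * (1 - eps) <= 1], the lower one
    [1 + eps <= expR eps]. The first-order terms in [eps] cancel, and [x * eps ^+ 2] vanishes at
    infinity. *)
Lemma xroot1_asymptotics x : 1 <= x ->
  1 / 2 - 5 / Num.sqrt x <= (expR 1 * xroot1 x - 1) * x <= expR (2 / Num.sqrt x) / 2.
Proof.
move=> x1; have x0 : 0 < x by lra.
have [ep0 ep1 ep2 ep3] := stirling_eps_le x1.
have /andP[s1 s2] := slope_bounds x0.
rewrite expR1_xroot1E//; set u := psi x - _ in s1 s2 *.
apply/andP; split; last first.
  apply: (@le_trans _ _ (expR (stirling_eps x) / 2)); last by rewrite ler_pM2r ?ler_expR// invr_gt0.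
  have h1 : expR (stirling_eps x) * (1 - stirling_eps x) <= 1.
    have := expR_ge1Dx (- stirling_eps x); rewrite expRN => h.
    apply: (le_trans (ler_wpM2l (expR_ge0 (stirling_eps x)) h)).
    by rewrite mulfV ?gt_eqF ?expR_gt0.
  have h2 : expR (stirling_eps x) * u <= 1 + expR (stirling_eps x) * (x^-1 / 2).
    apply: (@le_trans _ _ (expR (stirling_eps x) * (1 - stirling_eps x + x^-1 / 2))).
      by rewrite ler_pM2l ?expR_gt0//; lra.
    by rewrite mulrDr lerD2r.
  apply: (@le_trans _ _ ((expR (stirling_eps x) * (x^-1 / 2)) * x)).
    by rewrite ler_pM2r//; lra.
  by rewrite le_eqVlt; apply/orP; left; apply/eqP; move: (expR _) => E; field; rewrite gt_eqF.
have ix1 : x^-1 <= 1 by rewrite invf_le1.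
have ix0 : 0 < x^-1 by rewrite invr_gt0.
set w := 1 - stirling_eps x + x^-1 / 2 - x ^- 2 / 12.
have i2 : x ^- 2 <= x^-1 by rewrite -exprVn expr2 ler_piMl// ltW.
have i20 : 0 <= x ^- 2 by rewrite invr_ge0 sqr_ge0.
have w0 : 0 <= w by rewrite /w; lra.
have uw : w <= u by rewrite /w; lra.
have h1 : (1 + stirling_eps x) * w <= expR (stirling_eps x) * u.
  by rewrite ler_pM// ?expR_ge1Dx; lra.
have h2 : 1 - stirling_eps x ^+ 2 + x^-1 / 2 - x ^- 2 / 12 <= (1 + stirling_eps x) * w.
  by rewrite /w; nra.
apply: (@le_trans _ _ ((- stirling_eps x ^+ 2 + x^-1 / 2 - x ^- 2 / 12) * x)); last first.
  by rewrite ler_pM2r//; lra.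
have -> : (- stirling_eps x ^+ 2 + x^-1 / 2 - x ^- 2 / 12) * x = - (x * stirling_eps x ^+ 2) + 1 / 2 - x^-1 / 12.
  by field; rewrite gt_eqF.
have : x^-1 <= (Num.sqrt x)^-1.
  rewrite lef_pV2 ?posrE ?sqrtr_gt0//.
  have r1 : 1 <= Num.sqrt x by rewrite -sqrtr1 ler_wsqrtr.
  rewrite -[leRHS](sqr_sqrtr (ltW x0)) expr2 ler_peMl//; lra.
by move: (Num.sqrt x)^-1 (x^-1) ix0 ep3 => s i; lra.
Qed.

End root_concavity.

(** * Application to the gamma function: bounds and limits for the differences *)

Section gamma_root.
Context {R : realType}.
Implicit Types (x : R) (n : nat).

Let f := @lnGamma1 R.
Let G := xroot f.
Let G1 := xroot1 f digamma1.

Let df x : 0 < x -> is_derive x 1 f (digamma1 x).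
Proof. exact: (is_derive_bm lnGamma1S lnGamma1_1 lnGamma1_convex). Qed.

Let f_stirling x : 1 <= x -> 11 / 12 <= f x - (x * ln x - x + ln x / 2) <= 1.
Proof. exact: (stirling_bounds lnGamma1S lnGamma1_1 lnGamma1_convex). Qed.

Lemma GrootE x : 0 < x -> Groot x = G x.
Proof.
by move=> x0; rewrite /Groot /powR gt_eqF ?Gamma_gt0// mulrC.
Qed.

Lemma derive1_Groot x : 0 < x -> derive1 (@Groot R) x = G1 x.
Proof.
(* [Groot] and [G] are identified only at positive arguments, which suffices because differentiation
   is local. *)
move=> x0; rewrite derive1E (@near_eq_derive _ _ _ _ G).
  by have := is_derive_xroot df x0 => ?; exact: derive_val.
by near=> y; apply: GrootE; near: y; exact: lt_nbhsr.
Unshelve. all: by end_near. Qed.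

Lemma aGE x : 0 < x -> aG x = (expR 1 * G1 x - 1) * x.
Proof. by move=> x0; rewrite /aG derive1_Groot. Qed.

Lemma aG_div x : 0 < x -> 1 + aG x / x = expR 1 * G1 x.
Proof. by move=> x0; rewrite aGE// mulfK ?gt_eqF//; ring. Qed.

Lemma fact_rootE n : n.+1`!%:R `^ n.+1%:R^-1 = G n.+1%:R.
Proof.
rewrite /G /xroot /f (bm_nat lnGamma1S lnGamma1_1) /powR gt_eqF ?ltr0n ?fact_gt0//.
by rewrite mulrC.
Qed.

(** By the mean value theorem the difference is [expR 1 * G1 c] for some [c] strictly between [n]
    and [n + 1]; [G1] is strictly decreasing from 2 on. *)
Lemma Sdiff_bounds n : (2 <= n)%N ->
  expR 1 * G1 n.+1%:R < Sdiff R n /\ Sdiff R n < expR 1 * G1 n%:R.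
Proof.
case: n => [//|n] n2; rewrite /Sdiff !fact_rootE -mulrBr.
have N2 : (2 : R) <= n.+1%:R by rewrite ler_nat.
have NS : (n.+1%:R : R) < n.+2%:R by rewrite ltr_nat.
have [|c /andP[c1 c2] ->] := @MVT_derive _ G G1 _ _ NS.
  by move=> z /andP[z1 _]; apply: (is_derive_xroot df); lra.
rewrite (_ : n.+2%:R - n.+1%:R = 1 :> R) ?mulr1; last by rewrite -(natr1 n.+1); ring.
have decr := xroot1_decreasing df is_derive_digamma1 (@trigamma1_le R)
  (@digamma1_lower R) (@digamma1_upper R) f_stirling.
by split; rewrite ltr_pM2l ?expR_gt0//; apply: decr => //; lra.
Qed.

Lemma cvg_aG : aG (n%:R : R) @[n --> \oo] --> (1 / 2 : R).
Proof.
have r0 : (Num.sqrt (n%:R : R))^-1 @[n --> \oo] --> (0 : R).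
  apply/gtr0_cvgV0.
    by near=> n; rewrite sqrtr_gt0 ltr0n; near: n; exact: nbhs_infty_gt.
  apply/cvgryPge => M; near=> n.
  apply: (le_trans (ler_norm M)).
  rewrite -[leLHS]sqrtr_sqr ler_wsqrtr//.
  by near: n; exact: nbhs_infty_ger.
apply: (@squeeze_cvgr _ _ _ _ (fun n => 1 / 2 - 5 * (Num.sqrt (n%:R : R))^-1)
  (fun n => expR (2 * (Num.sqrt (n%:R : R))^-1) / 2)).
- near=> n; have n1 : (1 : R) <= n%:R.
    by rewrite ler1n; near: n; exact: nbhs_infty_gt.
  rewrite aGE; last by lra.
  exact: (xroot1_asymptotics (@digamma1_lower R) (@digamma1_upper R) f_stirling).
- rewrite -[X in _ --> X]subr0 -[X in _ --> _ - X](mulr0 5).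
  by apply: cvgB; [exact: cvg_cst|apply: cvgM => //; exact: cvg_cst].
- have -> : 1 / 2 = expR (2 * 0) / 2 :> R by rewrite mulr0 expR0.
  apply: cvgM; last exact: cvg_cst.
  apply: (cvg_comp (fun n => 2 * (Num.sqrt (n%:R : R))^-1)); last exact: continuous_expR.
  by apply: cvgM => //; exact: cvg_cst.
Unshelve. all: by end_near. Qed.

Lemma cvg_expR1_xroot1 : expR 1 * G1 (n%:R : R) @[n --> \oo] --> (1 : R).
Proof.
have i0 : (n%:R : R)^-1 @[n --> \oo] --> (0 : R).
  apply/gtr0_cvgV0; last exact: cvgr_idn.
  by near=> n; rewrite ltr0n; near: n; exact: nbhs_infty_gt.
have h : 1 + aG (n%:R : R) / n%:R @[n --> \oo] --> (1 : R).
  rewrite -[X in _ --> X]addr0 -[X in _ --> _ + X](mulr0 (1 / 2)).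
  by apply: cvgD; [exact: cvg_cst|apply: cvgM => //; exact: cvg_aG].
apply: cvg_trans h; apply: near_eq_cvg; near=> n.
by rewrite aG_div// ltr0n; near: n; exact: nbhs_infty_gt.
Unshelve. all: by end_near. Qed.

Lemma cvg_Sdiff : Sdiff R n @[n --> \oo] --> (1 : R).
Proof.
apply: (@squeeze_cvgr _ _ _ _ (fun n => expR 1 * G1 n.+1%:R) (fun n => expR 1 * G1 n%:R)).
- near=> n; have [|h1 h2] := @Sdiff_bounds n; last by rewrite !ltW.
  by near: n; exact: nbhs_infty_ge.
- by rewrite (cvg_shiftS (fun n => expR 1 * G1 n%:R)); exact: cvg_expR1_xroot1.
- exact: cvg_expR1_xroot1.
Unshelve. all: by end_near. Qed.

(** * Numerical checks for the first terms, and monotonicity *)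

Let sqrt2 : 1414 / 1000 <= Num.sqrt (2 : R) <= 1415 / 1000.
Proof.
have := sqr_sqrtr (ler0n R 2); have := sqrtr_ge0 (2 : R).
by move: (Num.sqrt _) => s s0 s2; apply/andP; split; nra.
Qed.

Let Sdiff1E : Sdiff R 1 = expR 1 * (Num.sqrt (2 : R) - 1).
Proof. by rewrite /Sdiff !factS fact0 !muln1 powR12_sqrt// powR1 mulrBr. Qed.

Lemma Sdiff1_lt : Sdiff R 1 < 115 / 100.
Proof.
have e64 : 363 / 1000 <= expR (- 1 : R).
  (* The bound [(1 - 1/64)^64 <= expR (- 1)], evaluated by six squarings, each rounded down. It
     gives [e <= 1 / 0.363], and [0.415 / 0.363 < 1.15]. *)
  have -> : - 1 = 64%:R * (- 1 / 64%:R) :> R by lra.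
  rewrite expRM_natl.
  have := expR_ge1Dx (- 1 / 64%:R : R).
  move: (expR _) => E h.
  have -> : E ^+ 64 = (((((E ^+ 2) ^+ 2) ^+ 2) ^+ 2) ^+ 2) ^+ 2 by rewrite -!exprM.
  have {h} : 9689 / 10000 <= E ^+ 2 by nra.
  move: (E ^+ 2) => {}E h; have {h} : 9387 / 10000 <= E ^+ 2 by nra.
  move: (E ^+ 2) => {}E h; have {h} : 8811 / 10000 <= E ^+ 2 by nra.
  move: (E ^+ 2) => {}E h; have {h} : 7763 / 10000 <= E ^+ 2 by nra.
  move: (E ^+ 2) => {}E h; have {h} : 6026 / 10000 <= E ^+ 2 by nra.
  by move: (E ^+ 2) => {}E h; nra.
have /andP[_ s2] := sqrt2.
have e_gt0 := expR_gt0 (1 : R).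
have : expR (1 : R) * expR (- 1) = 1 by rewrite -expRD addrN expR0.
rewrite Sdiff1E.
move: (expR 1) (expR (- 1)) (Num.sqrt 2) e64 s2 e_gt0 => e i s hi hs e0 ei.
nra.
Qed.

Let Sdiff2_lt : Sdiff R 2 < Sdiff R 1.
Proof.
rewrite Sdiff1E /Sdiff -mulrBr ltr_pM2l ?expR_gt0//.
rewrite (_ : 2`! = 2)%N // (_ : 3`! = 6)%N // powR12_sqrt//.
have /andP[s1 _] := sqrt2.
have c3 : ((6 : R) `^ 3^-1) ^+ 3 = 6.
  by rewrite -powR_mulrn ?powR_ge0// -powRrM mulVf// powRr1.
have := powR_ge0 (6 : R) (3^-1).
move: (_ `^ _) c3 (Num.sqrt 2) s1 => c c3 s s1 c0.
(* The claim is that the cube root of 6 is less than [2 * sqrt 2 - 1], which is at least 1.828; a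
   root of at least 1.828 would have a cube above 6. *)
have : c < 1828 / 1000; last by lra.
rewrite ltNge; apply/negP => h.
have : 33 / 10 <= c ^+ 2 by nra.
by move: c3; rewrite exprSr => c3 h2; nra.
Qed.

Lemma Sdiff_decreasing n : (1 <= n)%N -> Sdiff R n.+1 < Sdiff R n.
Proof.
case: n => [//|[_|n _]]; first exact: Sdiff2_lt.
(* The value [expR 1 * G1 n.+3%:R] separates the two consecutive differences. *)
have [_ h1] := @Sdiff_bounds n.+3 erefl; have [h2 _] := @Sdiff_bounds n.+2 erefl.
exact: lt_trans h1 h2.
Qed.

Lemma Sdiff_gt1 n : (1 <= n)%N -> 1 < Sdiff R n.
Proof.
(* A decreasing sequence is only weakly above its limit; passing to the next term first restores
   strictness. *)
move=> n1; apply: le_lt_trans (Sdiff_decreasing n1).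
have c : Sdiff R n.+1 @[n --> \oo] --> (1 : R).
  by rewrite (cvg_shiftS (Sdiff R)); exact: cvg_Sdiff.
rewrite -(cvg_lim (@norm_hausdorff _ R) c).
apply: (@nonincreasing_cvgn_ge _ (fun n => Sdiff R n.+1)); last exact: cvgP c.
by apply/nonincreasing_seqP => k; rewrite ltW// Sdiff_decreasing.
Qed.

End gamma_root.

Theorem theorem6p2 (R : realType) :
  [/\ (* (a) *)
      Sdiff R n @[n --> \oo] --> (1 : R),
      (* (b) *)
      [/\ Sdiff R 1 < 115 / 100,
          forall n : nat, (1 <= n)%N -> Sdiff R n.+1 < Sdiff R n
        & forall n : nat, (1 <= n)%N -> 1 < Sdiff R n],
      (* (c) *)
      forall n : nat, (18 <= n)%N ->
        1 + aG (n.+1%:R : R) / n.+1%:R < Sdiff R n /\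
        Sdiff R n < 1 + aG (n%:R : R) / n%:R
    & (* (d) *)
      aG (n%:R : R) @[n --> \oo] --> (1 / 2 : R)].
Proof.
split; [exact: cvg_Sdiff| split| |exact: cvg_aG].
- exact: Sdiff1_lt.
- exact: Sdiff_decreasing.
- exact: Sdiff_gt1.
- move=> n n18.
  rewrite !aG_div ?ltr0n ?(leq_trans _ n18)//.
  by apply: Sdiff_bounds; rewrite (leq_trans _ n18).
Qed.
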